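(* Let $(a_m)_{m\geq0}$ and $(b_m)_{m\geq0}$ be complex sequences with $a_0=b_0=1$, with exponential generating (formal power) series $$f(x)=\sum_{m\ge0}\frac{a_m}{m!}x^m,\qquad g(x)=\sum_{m\ge0}\frac{b_m}{m!}x^m.$$ For $x\in\mathbb{C}$ define the infinite lower-triangular matrices $A(x)=(A_{n,k}(x))_{n,k\geq1}$ and $B(x)=(B_{n,k}(x))_{n,k\geq1}$ by $$A_{n,k}(x)=(-1)^k\binom{n}{k}\sum_{m=0}^{n-k}\frac{(k-n)_m\,a_m}{m!}x^m,\qquad B_{n,k}(x)=(-1)^k\binom{n}{k}\sum_{m=0}^{n-k}\frac{(k-n)_m\,b_m}{m!}x^m$$ for $1\le k\le n$ (and $0$ for $k>n$). Then $A(x)$ and $B(x)$ are inverse of each other for all $x\in\mathbb{C}$ if and only if $$[x^{n-k}]\,f(-x)g(x)=\mathbf{1}_{n-k},\qquad 1\leq k\leq n,$$ where $\mathbf{1}_{n-k}=1$ if $n=k$ and $0$ otherwise.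
   Context: $[x^j]h(x)$ denotes the coefficient of $x^j$ in the power series $h(x)$. $(c)_0=1$ and $(c)_m=c(c+1)\cdots(c+m-1)$ is the Pochhammer symbol. *)

(* Defs.v *)
From mathcomp Require Import all_boot all_order all_algebra.
From mathcomp Require Import complex reals.

Set Implicit Arguments.
Unset Strict Implicit.
Unset Printing Implicit Defensive.

Import Order.TTheory GRing.Theory Num.Theory.
Local Open Scope ring_scope.

(* Formal power series are given by their coefficient sequences: [h j] is the
   coefficient of x^j in h(x). *)
Definition fps (K : fieldType) := nat -> K.

Definition fps_coef (K : fieldType) (j : nat) (h : fps K) : K := h j.

Definition fps_mul (K : fieldType) (g h : fps K) : fps K :=
  fun n => \sum_(0 <= i < n.+1) g i * h (n - i)%N.

(* h(c x) *)
Definition fps_scale (K : fieldType) (c : K) (h : fps K) : fps K :=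
  fun n => c ^+ n * h n.

Definition fps_egf (K : fieldType) (a : nat -> K) : fps K :=
  fun m => a m / m`!%:R.

Definition pochhammer (K : fieldType) (c : K) (m : nat) : K :=
  \prod_(0 <= i < m) (c + i%:R).

(* Infinite lower-triangular matrices M = (M_{n,k})_{n,k >= 1}. Indices start
   at 1: the entries with n = 0 or k = 0 are never used. *)
Definition infmx (K : fieldType) := nat -> nat -> K.

Definition polymx (K : fieldType) (a : nat -> K) (x : K) : infmx K :=
  fun n k =>
    if (k <= n)%N then
      (-1) ^+ k * 'C(n, k)%:R *
      \sum_(0 <= m < (n - k).+1)
        (pochhammer (k%:R - n%:R) m * a m / m`!%:R) * x ^+ m
    else 0.

(* The sum over all j >= 1 of M_{n,j} N_{j,k} stops at j = n, since
   M_{n,j} = 0 for j > n when M is lower triangular. *)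
Definition trigmx_mul (K : fieldType) (M N : infmx K) : infmx K :=
  fun n k => \sum_(1 <= j < n.+1) M n j * N j k.

Definition is_idmx (K : fieldType) (M : infmx K) : Prop :=
  forall n k : nat, (1 <= n)%N -> (1 <= k)%N -> M n k = (n == k)%:R.

Definition trigmx_inverses (K : fieldType) (M N : infmx K) : Prop :=
  is_idmx (trigmx_mul M N) /\ is_idmx (trigmx_mul N M).

(* Main.v *)
(* Since (k-n)_m / m! = (-1)^m binom(n-k, m), the entry A_{n,k}(x) is
   (-1)^k binom(n,k) P_{n-k}(x), where (P_d(x))_d has exponential generating
   function f(-xt) e^t; similarly for B(x) with g(-xt) e^t.  As
   binom(n,j) binom(j,k) = binom(n,k) binom(n-k,j-k), the (n,k) entry of
   A(x) B(x) is binom(n,k) (n-k)! times the coefficient of t^(n-k) in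
   f(-xt) e^t g(xt) e^(-t) = f(-xt) g(xt), that is, x^(n-k) times a positive
   multiple of [x^(n-k)] f(-x) g(x).  Setting x = 1 gives one direction. *)
Require Import Defs.
From mathcomp Require Import all_boot all_order all_algebra.
From mathcomp Require Import complex reals.
From mathcomp Require Import boolp ring.

Set Implicit Arguments.
Unset Strict Implicit.
Unset Printing Implicit Defensive.

Import Order.TTheory GRing.Theory Num.Theory.
Local Open Scope ring_scope.
Local Open Scope complex_scope.

Definition fps_one (K : fieldType) : fps K := fun n => (n == 0%N)%:R.

Definition fps_exp (K : fieldType) : fps K := fps_egf (fun=> 1).

(** A coefficient of a product depends only on finitely many coefficients of the factors. Truncation
    thus lets commutativity and associativity be inherited from [{poly K}]. *)
Lemma fps_mul_coef_poly (K : fieldType) (f g : fps K) (N n : nat) :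
  (n <= N)%N ->
  fps_mul f g n = (\poly_(i < N.+1) f i * \poly_(i < N.+1) g i)`_n.
Proof.
move=> leN; rewrite coefM /fps_mul big_mkord; apply: eq_bigr => i _.
rewrite !coef_poly !ltnS (leq_trans _ leN) -1?ltnS //.
by rewrite ltnS (leq_trans (leq_subr _ _) leN).
Qed.

Lemma fps_mulC (K : fieldType) (f g : fps K) : fps_mul f g = fps_mul g f.
Proof. by apply: funext => n; rewrite !(fps_mul_coef_poly _ _ (leqnn n)) mulrC. Qed.

Lemma fps_mulA (K : fieldType) (f g h : fps K) :
  fps_mul f (fps_mul g h) = fps_mul (fps_mul f g) h.
Proof.
apply: funext => n.
pose T (u : fps K) : {poly K} := \poly_(i < n.+1) u i.
have TE (u : fps K) i : (i <= n)%N -> (T u)`_i = u i.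
  by move=> lein; rewrite coef_poly ltnS lein.
transitivity ((T f * (T g * T h))`_n).
  rewrite coefM /fps_mul big_mkord; apply: eq_bigr => i _.
  rewrite TE -1?ltnS //; congr (_ * _).
  exact: (fps_mul_coef_poly g h (leq_subr i n)).
rewrite mulrA coefM /fps_mul big_mkord; apply: eq_bigr => i _.
rewrite (TE h) ?leq_subr //; congr (_ * _).
by rewrite -(@fps_mul_coef_poly _ f g) // -ltnS.
Qed.

Lemma fps_mul1 (K : fieldType) (f : fps K) : fps_mul (fps_one K) f = f.
Proof.
apply: funext => n; rewrite /fps_mul big_nat_recl //= mul1r subn0 big1 ?addr0 //.
by move=> i _; rewrite mul0r.
Qed.

Lemma fps_scaleM (K : fieldType) (c : K) (f g : fps K) :
  fps_scale c (fps_mul f g) = fps_mul (fps_scale c f) (fps_scale c g).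
Proof.
apply: funext => n; rewrite /fps_scale /fps_mul mulr_sumr !big_mkord.
apply: eq_bigr => i _; rewrite mulrACA -exprD subnKC //.
by rewrite -ltnS.
Qed.

Lemma fps_scale_scale (K : fieldType) (c d : K) (f : fps K) :
  fps_scale c (fps_scale d f) = fps_scale (c * d) f.
Proof. by apply: funext => n; rewrite /fps_scale mulrA -exprMn. Qed.

Lemma fps_scale_egf (K : fieldType) (c : K) (u : nat -> K) :
  fps_scale c (fps_egf u) = fps_egf (fun n => c ^+ n * u n).
Proof. by apply: funext => n; rewrite /fps_scale /fps_egf mulrA. Qed.

Lemma fact_neq0 (K : numFieldType) (n : nat) : n`!%:R != 0 :> K.
Proof. by rewrite pnatr_eq0 -lt0n fact_gt0. Qed.

Lemma fps_mul_egf (K : numFieldType) (u v : nat -> K) :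
  fps_mul (fps_egf u) (fps_egf v) =
  fps_egf (fun n => \sum_(i < n.+1) 'C(n, i)%:R * (u i * v (n - i)%N)).
Proof.
apply: funext => n; rewrite /fps_mul /fps_egf big_mkord mulr_suml.
apply: eq_bigr => i _; have lein : (i <= n)%N by rewrite -ltnS.
rewrite mulrACA -invfM mulrC [RHS]mulrAC; congr (_ * _).
rewrite -natrM -(bin_fact lein) [in RHS]natrM [in RHS]invfM mulrA divff ?mul1r //.
by rewrite pnatr_eq0 -lt0n bin_gt0.
Qed.

(** This is e^(-t) e^t = 1: the binomial convolution is the expansion of (1 - 1)^n. *)
Lemma fps_expN (K : numFieldType) :
  fps_mul (fps_scale (-1) (fps_exp K)) (fps_exp K) = fps_one K.
Proof.
rewrite /fps_exp fps_scale_egf fps_mul_egf; apply: funext => n.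
rewrite /fps_egf /fps_one; have := exprDn (1 : K) (-1) n.
rewrite subrr expr0n => sumE.
rewrite (_ : \sum_(i < n.+1) _ = (n == 0%N)%:R).
  by case: n {sumE} => [|n] /=; rewrite ?fact0 ?invr1 ?mul1r ?mul0r.
by rewrite sumE; apply: eq_bigr => i _; rewrite expr1n mul1r !mulr1 mulr_natl.
Qed.

Lemma pochhammerN (K : numFieldType) (d m : nat) :
  pochhammer (- d%:R : K) m = (-1) ^+ m * ('C(d, m) * m`!)%:R.
Proof.
rewrite bin_ffact /pochhammer; elim: m => [|m IHm].
  by rewrite big_nil ffactn0 mul1r.
rewrite big_nat_recr //= IHm ffactnSr exprSr natrM -!mulrA; congr (_ * _).
(* For d < m the truncated difference d - m is harmless, because the falling factorial beside it is
   already 0. *)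
have [ltdm|lemd] := ltnP d m; first by rewrite ffact_small // !(mul0r, mulr0).
by rewrite mulrCA natrB // mulN1r opprB [- _ + _]addrC.
Qed.

(** Both sides become n! after multiplication by k! i! (n-k-i)!. *)
Lemma mul_bin_bin (n k i : nat) : (i + k <= n)%N ->
  ('C(n, i + k) * 'C(i + k, k) = 'C(n, k) * 'C(n - k, i))%N.
Proof.
move=> lein; have lekn : (k <= n)%N := leq_trans (leq_addl i k) lein.
have lei : (i <= n - k)%N by rewrite leq_subRL // addnC.
apply/eqP; rewrite -(@eqn_pmul2r (k`! * (i`! * (n - k - i)`!))%N); last first.
  by rewrite !muln_gt0 !fact_gt0.
apply/eqP; transitivity n`!.
  rewrite -(bin_fact lein) -(bin_fact (leq_addl i k)) addnK.
  by rewrite addnC subnDA -!mulnA.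
by rewrite -(bin_fact lekn) -(bin_fact lei) mulnACA -mulnA.
Qed.

(** The polynomial P_d(x) left after removing the sign and the binomial prefactor from a matrix
    entry. *)
Definition polymx_gen (K : fieldType) (a : nat -> K) (x : K) (d : nat) : K :=
  \sum_(m < d.+1) 'C(d, m)%:R * ((- x) ^+ m * a m).

Lemma polymxE (K : numFieldType) (a : nat -> K) (x : K) (n k : nat) :
  (k <= n)%N ->
  polymx a x n k = (-1) ^+ k * 'C(n, k)%:R * polymx_gen a x (n - k).
Proof.
move=> lekn; rewrite /polymx lekn; congr (_ * _).
rewrite big_mkord; apply: eq_bigr => m _.
rewrite -opprB -natrB // pochhammerN natrM (exprNn x).
by have := fact_neq0 K m; move: (m`!%:R) => c c_neq0; field.
Qed.

Lemma egf_polymx_gen (K : numFieldType) (a : nat -> K) (x : K) :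
  fps_egf (polymx_gen a x) = fps_mul (fps_scale (- x) (fps_egf a)) (fps_exp K).
Proof.
rewrite fps_scale_egf fps_mul_egf; congr fps_egf; apply: funext => d.
by apply: eq_bigr => m _; rewrite mulr1.
Qed.

(** Scaling by -1 turns g(-xt) e^t into g(xt) e^(-t), whose exponential cancels the one in f(-xt)
    e^t. *)
Lemma fps_mul_polymx_gen (K : numFieldType) (a b : nat -> K) (x : K) :
  fps_mul (fps_scale (-1) (fps_egf (polymx_gen b x)))
          (fps_egf (polymx_gen a x)) =
  fps_scale x (fps_mul (fps_scale (-1) (fps_egf a)) (fps_egf b)).
Proof.
rewrite !egf_polymx_gen !fps_scaleM !fps_scale_scale mulN1r opprK mulrN1.
rewrite [fps_mul (fps_scale (- x) _) _]fps_mulC -fps_mulA.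
rewrite (fps_mulA (fps_scale (-1) _)) fps_expN fps_mul1.
exact: fps_mulC.
Qed.

Lemma trigmx_mul_polymx (K : numFieldType) (a b : nat -> K) (x : K) (n k : nat) :
  (1 <= k)%N -> (k <= n)%N ->
  trigmx_mul (polymx a x) (polymx b x) n k =
  'C(n, k)%:R * (n - k)`!%:R * (x ^+ (n - k) *
    fps_mul (fps_scale (-1) (fps_egf a)) (fps_egf b) (n - k)%N).
Proof.
move=> k_gt0 lekn.
rewrite -[x ^+ _ * _]/(fps_scale x _ _) -fps_mul_polymx_gen fps_scale_egf.
rewrite fps_mul_egf /fps_egf -mulrA [_%:R * (_ / _)]mulrC divfK ?fact_neq0 //.
(* The terms with j < k vanish since the right factor is lower triangular; the others are reindexed
   by j = i + k. *)
rewrite /trigmx_mul (big_cat_nat (n := k)) //=; last exact: leqW.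
rewrite big_nat big1 ?add0r => [|j /andP[_ ltjk]]; last first.
  by rewrite /(polymx b) leqNgt ltjk mulr0.
rewrite -{1}[k]add0n big_addn subSn // big_mkord mulr_sumr.
apply: eq_bigr => i _; have lei : (i <= n - k)%N by rewrite -ltnS.
have lein : (i + k <= n)%N by rewrite addnC -leq_subRL.
rewrite !polymxE ?leq_addl // addnK.
rewrite subnDA subnAC.
have /(congr1 (fun N : nat => N%:R : K)) := mul_bin_bin lein.
rewrite !natrM => binE.
(* The signs (-1)^(i+k) and (-1)^k of the two entries leave (-1)^i, which is the scaling by -1 in
   the series of [b]. *)
transitivity (('C(n, i + k)%:R * 'C(i + k, k)%:R) * ((-1) ^+ k) ^+ 2 *
    ((-1) ^+ i * polymx_gen b x i * polymx_gen a x (n - k - i))).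
  by rewrite exprD; ring.
by rewrite binE sqrr_sign mulr1 -[LHS]mulrA.
Qed.

Lemma trigmx_mul_polymx_id (K : numFieldType) (a b : nat -> K) (x : K) :
  (forall d, fps_mul (fps_scale (-1) (fps_egf a)) (fps_egf b) d = fps_one K d) ->
  is_idmx (trigmx_mul (polymx a x) (polymx b x)).
Proof.
move=> abE n k n_gt0 k_gt0; have [ltnk|lekn] := ltnP n k.
  rewrite (ltn_eqF ltnk) /trigmx_mul big_nat big1 // => j /andP[_ lejn].
  by rewrite /(polymx b) leqNgt (leq_trans lejn ltnk) mulr0.
rewrite trigmx_mul_polymx // abE /fps_one subn_eq0.
have [<-|neq_nk] := eqVneq n k.
  by rewrite leqnn subnn binn fact0 expr0 !mulr1.
by rewrite leqNgt ltn_neqAle eq_sym neq_nk lekn !mulr0.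
Qed.

(** Exchanging the two sequences replaces h(x) = f(-x) g(x) by h(-x), so the condition for A B also
    handles B A. *)
Lemma fps_mul_scaleN1_swap (K : fieldType) (f g : fps K) :
  fps_mul (fps_scale (-1) g) f = fps_scale (-1) (fps_mul (fps_scale (-1) f) g).
Proof.
rewrite fps_scaleM fps_scale_scale mulrNN mulr1 fps_mulC; congr fps_mul.
by apply: funext => n; rewrite /fps_scale expr1n mul1r.
Qed.

Theorem proposition2p1 (R : realType) (a b : nat -> R[i])
    (ha0 : a 0%N = 1) (hb0 : b 0%N = 1) :
  (forall x : R[i], trigmx_inverses (polymx a x) (polymx b x)) <->
  (forall n k : nat, (1 <= k)%N -> (k <= n)%N ->
     fps_coef (n - k) (fps_mul (fps_scale (-1) (fps_egf a)) (fps_egf b)) =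
     (n == k)%:R).
Proof.
split=> [invAB n k k_gt0 lekn | coefE x].
  have [/(_ n k (leq_trans k_gt0 lekn) k_gt0) + _] := invAB 1.
  rewrite trigmx_mul_polymx // expr1n mul1r /fps_coef.
  have [<-|neq_nk] := eqVneq n k; first by rewrite subnn binn fact0 !mul1r.
  (* Off the diagonal, the factors ['C(n, k)] and (n-k)! are nonzero in characteristic 0, so the
     coefficient itself is 0. *)
  move/eqP; rewrite !mulf_eq0 (negPf (fact_neq0 _ _)) pnatr_eq0.
  by rewrite eqn0Ngt bin_gt0 lekn => /eqP.
have abE d : fps_mul (fps_scale (-1) (fps_egf a)) (fps_egf b) d = fps_one R[i] d.
  (* Indices start at 1, so the coefficient of degree d is reached with n = d + 1 and k = 1. *)
  have := coefE d.+1 1%N isT isT.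
  by rewrite /fps_coef subn1 eqSS.
split; apply: trigmx_mul_polymx_id => // d.
rewrite fps_mul_scaleN1_swap /fps_scale abE /fps_one.
by case: d => [|d]; rewrite ?mulr0 ?mulr1.
Qed.
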